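(* Let $M=M[U,L]$ be a lattice path matroid of rank $r$ on $r+m$ elements, and let $\mathrm{st}(L)=(L_1,\dots,L_{r+m})$ and $\mathrm{st}(U)=(U_1,\dots,U_{r+m})$. Then the set $\mathcal{C}_M$ of step vectors of all generalized lattice paths of $M$ equals $$\left\{p\in\mathbb{R}^{r+m}\;\middle|\; 0\leq p_i\leq 1 \text{ and } \sum_{j=1}^i L_j\leq \sum_{j=1}^i p_j\leq \sum_{j=1}^i U_j \text{ for all } i\in\{1,\dots,r+m\} \right\}.$$
   Context: A lattice path from $(0,0)$ to $(m,r)$ is a path using unit steps $(1,0)$ and $(0,1)$; its step vector is $\mathrm{st}(P)=(P_1,\dots,P_{r+m})\in\{0,1\}^{r+m}$, where $P_i$ is the $y$-coordinate change of the $i$-th step. For lattice paths $U,L$ from $(0,0)$ to $(m,r)$ with $L$ never going above $U$, the lattice path matroid $M[U,L]$ is the matroid on $\{1,\dots,r+m\}$ whose bases are the sets $\{i: P_i=1\}$ for all lattice paths $P$ from $(0,0)$ to $(m,r)$ that never go above $U$ and never go below $L$; it has rank $r$. Let $R(M)$ be the closed region of the plane bounded by $U$ and $L$, let $l_i$ be the line $x+y=i$, and let $T_i=l_i\cap R(M)$ for $i=0,\dots,r+m$. A generalized lattice path $P$ of $M$ is a polygonal path with vertices (bend points) $(x_0,y_0),\dots,(x_{r+m},y_{r+m})$, where $(x_i,y_i)\in T_i$ for each $i$, and $x_i\le x_{i+1}$, $y_i\le y_{i+1}$ for $i=0,\dots,r+m-1$; its step vector is $\mathrm{st}(P)=(P_1,\dots,P_{r+m})$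 with $P_{i+1}=y_{i+1}-y_i$. *)

(* Defs.v *)
From HB Require Import structures.
From mathcomp Require Import all_boot all_order all_algebra.
From mathcomp Require Import classical_sets reals.

Set Implicit Arguments.
Unset Strict Implicit.
Unset Printing Implicit Defensive.

Import Order.TTheory GRing.Theory Num.Theory.
Local Open Scope ring_scope.

(* A sequence of unit steps is a sequence of booleans: [true] is the step      *)
(* (0,1) and [false] is the step (1,0).  The vertex reached from the origin    *)
(* after the first [i] steps of [s] is [vertex s i].                           *)
Definition vertex (s : seq bool) (i : nat) : nat * nat :=
  (count negb (take i s), count id (take i s)).

Definition lattice_path (m r : nat) : Type :=
  {s : (r + m).-tuple bool | vertex s (r + m) == (m, r)}.

(* [P] never goes above [Q]: every vertex of [P] has a vertex of [Q] in the    *)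
(* same column at least as high.  Testing vertices is enough because both      *)
(* paths are lattice paths between the same two points.                        *)
Definition never_above (m r : nat) (P Q : lattice_path m r) : bool :=
  [forall i : 'I_(r + m).+1, exists j : 'I_(r + m).+1,
    ((vertex (val P) i).1 == (vertex (val Q) j).1)
    && ((vertex (val P) i).2 <= (vertex (val Q) j).2)%N].

Definition never_below (m r : nat) (P Q : lattice_path m r) : bool :=
  [forall i : 'I_(r + m).+1, exists j : 'I_(r + m).+1,
    ((vertex (val P) i).1 == (vertex (val Q) j).1)
    && ((vertex (val Q) j).2 <= (vertex (val P) i).2)%N].

(* The matroid M[U,L], given by its bounding paths; its ground set is          *)
(* ['I_(r + m)] (the element i of {1,...,r+m} being the ordinal i-1) and its   *)
(* bases are [bases M] below.                                                  *)
Record lattice_path_matroid (m r : nat) : Type := LatticePathMatroid {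
  upper : lattice_path m r;
  lower : lattice_path m r;
  lower_never_above_upper : never_above lower upper
}.

Definition north_steps (m r : nat) (P : lattice_path m r) : {set 'I_(r + m)} :=
  [set i | tnth (val P) i]%SET.

Definition bases (m r : nat) (M : lattice_path_matroid m r) :
    {set {set 'I_(r + m)}} :=
  [set north_steps P
    | P : lattice_path m r & never_above P (upper M) && never_below P (lower M)]%SET.

Definition st (R : realType) (m r : nat) (P : lattice_path m r) :
    'rV[R]_(r + m) :=
  \row_i (tnth (val P) i)%:R.

Local Open Scope classical_set_scope.

Definition plane_vertex (R : realType) (m r : nat) (P : lattice_path m r)
    (i : nat) : R * R :=
  ((vertex (val P) i).1%:R, (vertex (val P) i).2%:R).

(* The lattice path as a subset of the plane.  The vertices are listed apart   *)
(* from the unit segments so that the path without steps is the origin.        *)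
Definition path_points (R : realType) (m r : nat) (P : lattice_path m r) :
    set (R * R) :=
  [set q | (exists i : 'I_(r + m).+1, q = plane_vertex R P i) \/
    (exists (i : 'I_(r + m)) (t : R), 0 <= t <= 1 /\
      q = ((1 - t) * (plane_vertex R P i).1 + t * (plane_vertex R P i.+1).1,
           (1 - t) * (plane_vertex R P i).2 + t * (plane_vertex R P i.+1).2))].
Arguments path_points R {m r} P _.

(* The closed region bounded by U and L: the union of the vertical segments    *)
(* going from a point of L up to a point of U.                                 *)
Definition region (R : realType) (m r : nat) (M : lattice_path_matroid m r) :
    set (R * R) :=
  [set q | exists l u : R,
    [/\ path_points R (lower M) (q.1, l), path_points R (upper M) (q.1, u)
      & l <= q.2 <= u]].
Arguments region R {m r} M _.

Definition antidiagonal (R : realType) (i : nat) : set (R * R) :=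
  [set q | q.1 + q.2 = i%:R].
Arguments antidiagonal : clear implicits.

Definition T_ (R : realType) (m r : nat) (M : lattice_path_matroid m r)
    (i : nat) : set (R * R) :=
  antidiagonal R i `&` region R M.
Arguments T_ R {m r} M i _.

(* A generalized lattice path is given by its bend points; for                 *)
(* [i : 'I_(r + m)], [widen_ord (leqnSn _) i] and [lift ord0 i] are the        *)
(* indices i and i+1 in {0,...,r+m}.                                           *)
Definition generalized_lattice_path (R : realType) (m r : nat)
    (M : lattice_path_matroid m r) : set ('I_(r + m).+1 -> R * R) :=
  [set v | (forall i : 'I_(r + m).+1, T_ R M i (v i)) /\
    (forall i : 'I_(r + m),
      (v (widen_ord (leqnSn _) i)).1 <= (v (lift ord0 i)).1 /\
      (v (widen_ord (leqnSn _) i)).2 <= (v (lift ord0 i)).2)].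
Arguments generalized_lattice_path R {m r} M _.

Definition generalized_st (R : realType) (n : nat) (v : 'I_n.+1 -> R * R) :
    'rV[R]_n :=
  \row_(i < n) ((v (lift ord0 i)).2 - (v (widen_ord (leqnSn _) i)).2).

Definition C_ (R : realType) (m r : nat) (M : lattice_path_matroid m r) :
    set 'rV[R]_(r + m) :=
  [set generalized_st v | v in generalized_lattice_path R M].
Arguments C_ R {m r} M _.

(* Main.v *)
Require Import Defs.
From HB Require Import structures.
From mathcomp Require Import all_boot all_order all_algebra.
From mathcomp Require Import classical_sets reals.
From mathcomp Require Import ring lra.

(** Every point of a lattice path with vertices (a_k, b_k) lies on a segment
    between consecutive vertices, along which x + y grows from k to k + 1.
    Hence a point (x, y) of the line x + y = i lies on or above L exactly when
    b_i(L) <= y, and on or below U exactly when y <= b_i(U): the slice T_i is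
    cut out by these two inequalities on y.  The partial sums of a step vector
    are the heights of the bend points, and those of st(L) and st(U) are the
    heights b_i(L) and b_i(U).  On x + y = i, x_i <= x_{i+1} says that the step
    y_{i+1} - y_i is at most 1. *)

Set Implicit Arguments.
Unset Strict Implicit.
Unset Printing Implicit Defensive.

Import Order.TTheory GRing.Theory Num.Theory.
Local Open Scope classical_set_scope.
Local Open Scope ring_scope.

Lemma vertexS (s : seq bool) (k : nat) : (k < size s)%N ->
  vertex s k.+1 = ((vertex s k).1 + ~~ nth false s k,
                   (vertex s k).2 + nth false s k)%N.
Proof.
by move=> ks; rewrite /vertex (take_nth false ks) -!cats1 !count_cat /= !addn0.
Qed.

Lemma vertex_sum (s : seq bool) (k : nat) : (k <= size s)%N ->
  ((vertex s k).1 + (vertex s k).2)%N = k.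
Proof.
by move=> ks; rewrite /vertex /= addnC (count_predC id) size_takel.
Qed.

Lemma vertex_le (s : seq bool) (i j : nat) : (i <= j)%N ->
  ((vertex s i).1 <= (vertex s j).1)%N /\ ((vertex s i).2 <= (vertex s j).2)%N.
Proof.
move=> ij; rewrite /vertex /= -(cat_take_drop i (take j s)) take_takel //.
by rewrite !count_cat !leq_addr.
Qed.

Section PlaneVertex.
Variables (R : realType) (m r : nat) (P : lattice_path m r).
Local Notation V := (plane_vertex R P).

Lemma plane_vertex0 : V 0 = (0, 0).
Proof. by rewrite /plane_vertex /vertex take0. Qed.

Lemma plane_vertex_end : (V (r + m)).1 = m%:R.
Proof. by rewrite /plane_vertex (eqP (valP P)). Qed.

Lemma plane_vertex_sum (k : nat) : (k <= r + m)%N -> (V k).1 + (V k).2 = k%:R.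
Proof. by move=> kn; rewrite -natrD vertex_sum ?size_tuple. Qed.

Lemma plane_vertex_le (i j : nat) : (i <= j)%N ->
  (V i).1 <= (V j).1 /\ (V i).2 <= (V j).2.
Proof. by move=> /(vertex_le (val P)) []; rewrite !ler_nat. Qed.

(** One formula with increments [1 - st] and [st] covers both kinds of step. *)
Lemma plane_vertexS (k : 'I_(r + m)) :
  (V k.+1).1 = (V k).1 + (1 - st R P 0 k) /\
  (V k.+1).2 = (V k).2 + st R P 0 k.
Proof.
rewrite /plane_vertex vertexS ?size_tuple // mxE (tnth_nth false) !natrD.
by case: nth; rewrite /= ?subrr ?subr0.
Qed.

Lemma st01 (k : 'I_(r + m)) : st R P 0 k = 0 \/ st R P 0 k = 1.
Proof. by rewrite mxE; case: (tnth _ _); [right|left]. Qed.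

(** Both coordinates grow weakly along the path, so its points before the line x + y = i have
    abscissa at most that of vertex i, and those after it at least that. *)
Lemma path_points_antidiagonal (x y : R) (i : nat) : (i <= r + m)%N ->
  path_points R P (x, y) ->
  (x + y <= i%:R -> x <= (V i).1) /\ (i%:R <= x + y -> (V i).1 <= x).
Proof.
move=> ilen [[k [-> ->]]|[k [t [/andP[t0 t1] /pair_equal_spec[-> ->]]]]].
  rewrite -[_%:R + _]/((V k).1 + (V k).2) (plane_vertex_sum (leq_ord k)).
  by split; rewrite ler_nat => /plane_vertex_le [].
have [-> ->] := plane_vertexS k.
have s := plane_vertex_sum (ltnW (ltn_ord k)).
have t_sum (a b c : R) : (1 - t) * a + t * (a + (1 - c))
    + ((1 - t) * b + t * (b + c)) = a + b + t by ring.
have c0 : 0 <= 1 - st R P 0 k by case: (st01 k) => ->; lra.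
(* The abscissa of the point is that of vertex k plus this product; bounding it here leaves only
   linear arithmetic. *)
have tc : 0 <= t * (1 - st R P 0 k) <= 1 - st R P 0 k by nra.
rewrite t_sum s; have [ik|ki] := leqP i k.
  have ikR : i%:R <= k%:R :> R by rewrite ler_nat.
  have [Vik _] := plane_vertex_le ik.
  split=> h; last by lra.
  (* Here i <= k and k + t <= i, so the point is vertex i itself. *)
  have t_0 : t = 0 by lra.
  have ki : (k <= i)%N by rewrite -(ler_nat R); lra.
  have [+ _] := plane_vertex_le ki.
  by rewrite t_0; lra.
have kiR : k%:R + 1 <= i%:R :> R by rewrite natr1 ler_nat.
have [+ _] := plane_vertex_le ki; rewrite (plane_vertexS k).1 => Vki.
split=> h; first by lra.
have t_1 : t = 1 by lra.
have ik : (i <= k.+1)%N by rewrite -(ler_nat R) -natr1; lra.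
have [+ _] := plane_vertex_le ik; rewrite (plane_vertexS k).1.
by rewrite t_1; lra.
Qed.

(** A discrete intermediate value theorem, by induction on the last vertex; the height bounds locate
    the point relative to a given vertex. *)
Lemma path_points_ivt (i j : nat) (x : R) : (i <= j <= r + m)%N ->
  (V i).1 <= x <= (V j).1 ->
  exists2 y, path_points R P (x, y) & (V i).2 <= y <= (V j).2.
Proof.
elim: j => [|j IH] /andP[ij jn] /andP[ix xj].
  move: ij ix; rewrite leqn0 => /eqP -> ix.
  exists (V 0).2; last by rewrite lexx.
  left; exists ord0; rewrite [RHS]surjective_pairing; congr pair.
  by apply/le_anti/andP; split.
have [eij|nij] := eqVneq i j.+1.
  rewrite eij in ix *; exists (V j.+1).2; last by rewrite lexx.
  left; exists (Ordinal (jn : (j.+1 < (r + m).+1)%N)).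
  rewrite [RHS]surjective_pairing; congr pair.
  by apply/le_anti/andP; split.
have {nij}ij : (i <= j)%N by rewrite -ltnS ltn_neqAle nij.
have [xVj|Vjx] := leP x (V j).1.
  have [||y Py /andP[iy yj]] := IH; first by rewrite ij ltnW.
    by rewrite ix.
  exists y => //; rewrite iy (le_trans yj) //.
  by have [] := plane_vertex_le (leqnSn j).
have [e1 e2] := plane_vertexS (Ordinal jn).
have [_ Vij] := plane_vertex_le ij.
rewrite -[j.+1]/(Ordinal jn).+1 e1 -[nat_of_ord _]/j in xj.
rewrite -[j.+1]/(Ordinal jn).+1 e2 -[nat_of_ord _]/j.
(* x can only exceed (V j).1 if step j is horizontal. *)
case: (st01 (Ordinal jn)) => c; rewrite c in e1 e2 xj *; last by lra.
exists (V j).2; last by lra.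
right; exists (Ordinal jn), (x - (V j).1); split; first by lra.
by rewrite e1 e2 -[nat_of_ord _]/j; congr pair; lra.
Qed.

End PlaneVertex.

Lemma T_P (R : realType) (m r : nat) (M : lattice_path_matroid m r)
    (i : nat) (q : R * R) : (i <= r + m)%N ->
  T_ R M i q <->
  q.1 + q.2 = i%:R /\
  (plane_vertex R (lower M) i).2 <= q.2 <= (plane_vertex R (upper M) i).2.
Proof.
move=> ilen.
have sL := plane_vertex_sum R (lower M) ilen.
have sU := plane_vertex_sum R (upper M) ilen.
split=> [[qi [l [u [Ll Uu /andP[lq qu]]]]]|[qi /andP[Lq qU]]].
  rewrite /antidiagonal /= in qi.
  (* As l <= y <= u, the point of L is not beyond the line x + y = i and the point of U not before
     it. *)
  have [hL _] := path_points_antidiagonal ilen Ll.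
  have [_ hU] := path_points_antidiagonal ilen Uu.
  have {}hL : q.1 <= (plane_vertex R (lower M) i).1 by apply: hL; lra.
  have {}hU : (plane_vertex R (upper M) i).1 <= q.1 by apply: hU; lra.
  by split=> //; apply/andP; split; lra.
have qL : q.1 <= (plane_vertex R (lower M) i).1 by lra.
have Uq : (plane_vertex R (upper M) i).1 <= q.1 by lra.
have q0 : 0 <= q.1 by apply: le_trans Uq; rewrite ler0n.
have qm : q.1 <= m%:R.
  apply: (le_trans qL); rewrite -(plane_vertex_end R (lower M)).
  by have [] := plane_vertex_le R (lower M) ilen.
have [||l Ll /andP[_ li]] :=
  @path_points_ivt R m r (lower M) 0 i q.1; first by rewrite ilen.
  by rewrite plane_vertex0 q0.
have [||u Uu /andP[iu _]] :=
  @path_points_ivt R m r (upper M) i (r + m) q.1; first by rewrite ilen leqnn.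
  by rewrite plane_vertex_end Uq.
split=> //; exists l, u; split=> //.
by rewrite (le_trans li Lq) (le_trans qU iu).
Qed.

Lemma sum_ord_ltS (V : zmodType) (n : nat) (F : 'I_n -> V) (i : 'I_n) :
  \sum_(j < n | (j < i.+1)%N) F j = \sum_(j < n | (j < i)%N) F j + F i.
Proof.
rewrite (bigD1 i) //= addrC; congr (_ + _); apply: eq_bigl => j.
by rewrite ltnS ltn_neqAle andbC -val_eqE.
Qed.

Lemma telescope_sum_ord (V : zmodType) (n : nat) (F : 'I_n -> V)
    (f : nat -> V) (k : nat) :
  (forall i : 'I_n, F i = f i.+1 - f i) -> (k <= n)%N ->
  \sum_(j < n | (j < k)%N) F j = f k - f 0.
Proof.
move=> Ff; elim: k => [|k IH] kn; first by rewrite big_pred0 ?subrr.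
rewrite (sum_ord_ltS F (Ordinal kn)) IH ?(ltnW kn) // Ff /=.
by rewrite addrC addrA subrK.
Qed.

Lemma sum_st (R : realType) (m r : nat) (P : lattice_path m r) (k : nat) :
  (k <= r + m)%N ->
  \sum_(j < r + m | (j < k)%N) st R P 0 j = (plane_vertex R P k).2.
Proof.
move=> kn; rewrite (telescope_sum_ord (f := fun k => (plane_vertex R P k).2)) //.
  by rewrite plane_vertex0 subr0.
by move=> i; rewrite (plane_vertexS R P i).2 addrC addKr.
Qed.

Theorem theorem3p3 (R : realType) (m r : nat) (M : lattice_path_matroid m r) :
  C_ R M =
  [set p : 'rV[R]_(r + m) | forall i : 'I_(r + m),
    0 <= p 0 i <= 1 /\
    \sum_(j < r + m | (j <= i)%N) st R (lower M) 0 j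
      <= \sum_(j < r + m | (j <= i)%N) p 0 j
      <= \sum_(j < r + m | (j <= i)%N) st R (upper M) 0 j].
Proof.
apply/seteqP; split=> [p [v [Tv v_le] <-] i|p pP].
  have Tv' k := (T_P M (v k) (ltn_ord k : (k <= r + m)%N)).1 (Tv k).
  split.
    have [[s _] [s' _] [x_le y_le]] :=
      And3 (Tv' (widen_ord (leqnSn _) i)) (Tv' (lift ord0 i)) (v_le i).
    rewrite mxE; move: s s'; rewrite /= /bump /= add1n -natr1; lra.
  (* Both paths start at the origin, so the slice of index 0 is the origin. *)
  have v0 : (v ord0).2 = 0.
    by have [_] := Tv' ord0; rewrite !plane_vertex0 /=; lra.
  have -> : \sum_(j < r + m | (j <= i)%N) generalized_st v 0 j
      = (v (lift ord0 i)).2.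
    (* [inord] extends the bend points to [nat]; its default value is never met. The condition
       [j <= i] is convertible to [j < i.+1]. *)
    rewrite (telescope_sum_ord (k := i.+1) (f := fun k => (v (inord k)).2)) //.
      rewrite (_ : inord 0 = ord0) ?v0 ?subr0; last first.
        by apply/val_inj; rewrite /= inordK.
      by congr (v _).2; apply/val_inj; rewrite /= inordK ?ltnS.
    move=> k; rewrite mxE; congr ((v _).2 - (v _).2); apply/val_inj.
      by rewrite /= inordK ?ltnS.
    by rewrite /= inordK // ltnW // ltnS.
  have [_] := Tv' (lift ord0 i).
  by rewrite -!sum_st ?leq_ord.
pose S k := \sum_(j < r + m | (j < k)%N) p 0 j.
have S0 : S 0 = 0 by rewrite /S big_pred0.
have SS (i : 'I_(r + m)) : S i.+1 = S i + p 0 i by apply: sum_ord_ltS.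
(* The heights must be the partial sums of p, and x + y = k then fixes the abscissas. *)
exists (fun k : 'I_(r + m).+1 => (k%:R - S k, S k)); last first.
  by apply/rowP => i; rewrite mxE /= /bump /= add1n SS addrC addKr.
split=> [[[|k] kn]|i].
(* Index 0 is separate: the hypothesis at ordinal k bounds the sum of the first k + 1 entries. *)
- by apply/T_P => //; rewrite !plane_vertex0 /= S0 lexx subr0 addr0.
- apply/T_P => //; split; first by rewrite subrK.
  by rewrite -!sum_st //; have [_] := pP (Ordinal (kn : (k < r + m)%N)).
- by have [p01 _] := pP i; rewrite /= /bump /= add1n SS -natr1; lra.
Qed.
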